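(* Let $\mathcal C\subseteq\mathbb C$ be a subfield, let $A\in\operatorname{GL}_d(\mathcal C(z))$ and let $q\in\mathcal C[z]$ be irreducible. Suppose that $A$ has a single and simple pole at $q$ and that the system $[A]_\phi$ is desingularizable at $q$. Then there exist an integer $n\ge 1$, unimodular polynomial matrices $S_1,\dots,S_n\in\operatorname{Mat}_d(\mathcal C[z])$ and diagonal polynomial matrices $D_1,\dots,D_n\in\operatorname{Mat}_d(\mathcal C[z])$ such that $$T=S_1\cdot D_1\cdots S_n\cdot D_n$$ is a desingularizing transformation for $[A]_\phi$ at $q$. Furthermore, any other desingularizing transformation $T'$ for $[A]_\phi$ at $q$ can be written as $T'=T\cdot\tilde T$ with $\tilde T\in\operatorname{GL}_d(\mathcal C(z))\cap\operatorname{Mat}_d(\mathcal C[z])$.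
   Context: $\phi$ is the $\mathcal C$-automorphism of $\mathcal C(z)$ with $\phi(z)=z+1$, applied entrywise to matrices. $[A]_\phi$ denotes the difference system $\phi(Y)=AY$. For $T\in\operatorname{GL}_d(\mathcal C(z))$ put $T[A]_\phi:=\phi(T^{-1})AT$. $\operatorname{Mat}_d(\mathcal C[z])$ is the set of $d\times d$ matrices with polynomial entries; a polynomial matrix is unimodular if its inverse is also a polynomial matrix. For an irreducible $p\in\mathcal C[z]$, $\operatorname{ord}_p$ is the $p$-adic valuation on $\mathcal C(z)$ ($\operatorname{ord}_p(0)=+\infty$), and for a matrix $\operatorname{ord}_p(A)$ is the minimum of the orders of the entries. $A$ has a pole at $q$ if $\operatorname{ord}_q(A)<0$. ''Single and simple pole at $q$'' means that $A$ has a pole at $q$ and $qA$ has polynomial entries. (Such a $q$ is automatically a $\phi$-minimal pole, i.e. $\phi^j(q)$ does not divide the common denominator of $A$ for any integer $j\ge1$.) For a $\phi$-minimal pole $q$ of $A$, a desingularizing transformation for $[A]_\phi$ at $q$ is a matrix $T\in\operatorname{GL}_d(\mathcal C(z))\cap\operatorname{Mat}_d(\mathcal C[z])$ such that $\operatorname{ord}_q(T[A]_\phi)\ge 0$ and $\operatorname{ord}_p(T[A]_\phi)\ge\operatorname{ord}_p(A)$ for every other irreducible polynomial $p\in\mathcal C[z]$ (not associate to $q$). $[A]_\phi$ is desingularizable at $q$ if such a $T$ exists. *)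

(* Defs.v *)
From HB Require Import structures.
From mathcomp Require Import all_boot all_order all_algebra.
From mathcomp Require Import constructive_ereal.

Set Implicit Arguments.
Unset Strict Implicit.
Unset Printing Implicit Defensive.

Import Order.TTheory GRing.Theory Num.Theory.
Local Open Scope ring_scope.

Notation "x %:F" := (FracField.tofrac x) : ring_scope.

(* A polynomial matrix regarded as a matrix over the rational functions *)
Notation ratmx := (map_mx (@FracField.tofrac _)).

Section RationalFunctions.
Variable C : fieldType.
Local Notation ratfun := {fraction {poly C}}.
Implicit Types (f g : ratfun) (a b p q : {poly C}).

Definition numf f : {poly C} := \n_(repr f).
Definition denf f : {poly C} := \d_(repr f).

Lemma denf_neq0 f : denf f != 0. Proof. exact: denom_ratioP. Qed.

Lemma numf_denf f : f = (numf f)%:F / (denf f)%:F.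
Proof.
have d0 := denf_neq0 f; apply: (@mulIf _ (denf f)%:F); first by rewrite tofrac_eq0.
rewrite divfK ?tofrac_eq0 // /numf -{1}(reprK f).
move: d0; rewrite /denf; move: (repr f) => x d0.
apply/eqP; unlock FracField.tofrac; rewrite -[_ * _]FracField.pi_mul.
rewrite FracField.equivf_def /FracField.mulf !numden_Ratio ?mulr1 ?mul1r ?oner_eq0 //.
by rewrite mulrC.
Qed.

Lemma eq_divF a b a' b' : b != 0 -> b' != 0 ->
  (a%:F / b%:F == a'%:F / b'%:F) = (a * b' == a' * b).
Proof.
by move=> b0 b'0; rewrite eqr_div ?tofrac_eq0 // -!tofracM tofrac_eq.
Qed.

(* The substitution z := z + c; the automorphism phi is [shift 1]. *)
Definition shift (c : C) f : ratfun :=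
  (numf f \Po ('X + c%:P))%:F / (denf f \Po ('X + c%:P))%:F.

Lemma comp_XaddC_eq0 (c : C) p : (p \Po ('X + c%:P) == 0) = (p == 0).
Proof. by rewrite comp_poly2_eq0 // size_XaddC. Qed.

Lemma shift_div c a b : b != 0 ->
  shift c (a%:F / b%:F) = (a \Po ('X + c%:P))%:F / (b \Po ('X + c%:P))%:F.
Proof.
move=> b0; set f := _ / _; have d0 := denf_neq0 f.
have /eqP := numf_denf f; rewrite {1}/f eq_divF // => /eqP e.
apply/eqP; rewrite /shift eq_divF ?comp_XaddC_eq0 //.
by rewrite -!comp_polyM e.
Qed.

Lemma shift_poly c a : shift c a%:F = (a \Po ('X + c%:P))%:F.
Proof.
by rewrite -[a%:F]divr1 -tofrac1 shift_div ?oner_eq0 // comp_polyC tofrac1 divr1.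
Qed.

Lemma shiftC c (x : C) : shift c (x%:P)%:F = (x%:P)%:F.
Proof. by rewrite shift_poly comp_polyC. Qed.

Lemma shiftX c : shift c 'X%:F = 'X%:F + (c%:P)%:F.
Proof. by rewrite shift_poly comp_polyX tofracD. Qed.

Fact shift_zmod_morphism c : zmod_morphism (shift c).
Proof.
move=> f g; rewrite (numf_denf f) (numf_denf g).
move: (denf_neq0 f) (denf_neq0 g).
move: (numf f) (denf f) (numf g) (denf g) => a b a' b' b0 b'0.
have h (x y x' y' : {poly C}) : y != 0 -> y' != 0 ->
    x%:F / y%:F - x'%:F / y'%:F = (x * y' - x' * y)%:F / (y * y')%:F.
  move=> y0 y'0; rewrite -mulNr addf_div ?tofrac_eq0 // mulNr.
  by rewrite -!tofracM -tofracB.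
rewrite h // !shift_div ?mulf_neq0 // h ?comp_XaddC_eq0 //.
by rewrite comp_polyB !comp_polyM.
Qed.

Fact shift_monoid_morphism c : monoid_morphism (shift c).
Proof.
split=> [|f g]; first by rewrite -tofrac1 shift_poly comp_polyC.
rewrite (numf_denf f) (numf_denf g).
move: (denf_neq0 f) (denf_neq0 g).
move: (numf f) (denf f) (numf g) (denf g) => a b a' b' b0 b'0.
rewrite mulf_div -!tofracM !shift_div ?mulf_neq0 //.
by rewrite mulf_div -!tofracM !comp_polyM.
Qed.

HB.instance Definition _ c :=
  GRing.isZmodMorphism.Build ratfun ratfun (shift c) (shift_zmod_morphism c).
HB.instance Definition _ c :=
  GRing.isMonoidMorphism.Build ratfun ratfun (shift c) (shift_monoid_morphism c).

Lemma shiftK c : cancel (shift c) (shift (- c)).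
Proof.
have h p : (p \Po ('X + c%:P)) \Po ('X + (- c)%:P) = p.
  rewrite -comp_polyA comp_polyD comp_polyX comp_polyC polyCN.
  by rewrite addrNK comp_polyXr.
move=> f; rewrite {2}(numf_denf f) [shift c f]/shift.
by rewrite shift_div ?comp_XaddC_eq0 ?denf_neq0 // !h.
Qed.

Lemma shift_bij c : bijective (shift c).
Proof. by exists (shift (- c)) => [|f]; [|rewrite -{1}[c]opprK]; exact: shiftK. Qed.

Definition phi : ratfun -> ratfun := shift 1.
HB.instance Definition _ := GRing.RMorphism.on phi.

(* If p is not constant and a <> 0, then p ^+ k %| a forces k < size a, so the
   bound on k is harmless. *)
Definition multp p a : nat := \max_(k < size a | p ^+ k %| a) k.

Lemma multpP p a k : (1 < size p)%N -> a != 0 ->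
  (p ^+ k %| a) = (k <= multp p a)%N.
Proof.
move=> p1 a0.
have lt_size j : p ^+ j %| a -> (j < size a)%N.
  move=> /dvdp_leq -/(_ a0) le_a; apply: leq_trans le_a.
  rewrite -(@ltn_predK 0 (size (p ^+ j))) ?ltnS ?size_exp.
    by rewrite leq_pmull // -subn1 subn_gt0.
  by rewrite size_poly_gt0 expf_neq0 // -size_poly_gt0 ltnW.
apply/idP/idP => [pk|].
  exact: (@leq_bigmax_cond _ _ (fun i : 'I__ => i : nat) (Ordinal (lt_size _ pk))).
have a_gt0 : (0 < size a)%N by rewrite size_poly_gt0.
have [i pi ->] : {i : 'I_(size a) | p ^+ i %| a & multp p a = i}.
  apply: eq_bigmax_cond; apply/card_gt0P; exists (Ordinal a_gt0).
  rewrite -topredE /=; exact: dvd1p.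
by move=> le_ki; apply: dvdp_trans pi; exact: dvdp_exp2l.
Qed.

(* The p-adic valuation, for p irreducible *)
Definition ordp p f : \bar int :=
  if f == 0 then +oo%E else ((multp p (numf f))%:Z - (multp p (denf f))%:Z)%:E.

Lemma multpM p a b : irreducible_poly p -> a != 0 -> b != 0 ->
  multp p (a * b) = (multp p a + multp p b)%N.
Proof.
move=> pI a0 b0; have [p1 _] := pI.
have p0 : p != 0 by rewrite -size_poly_gt0 ltnW.
have split_mult c : c != 0 -> exists2 c', c = p ^+ multp p c * c' & ~~ (p %| c').
  move=> c0; have : p ^+ multp p c %| c by rewrite multpP.
  case/dvdpP=> c' ec; exists c'; first by rewrite {1}ec mulrC.
  apply/negP => /dvdpP[d ed].
  have : p ^+ (multp p c).+1 %| c.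
    by rewrite {2}ec ed exprS -mulrA dvdp_mull.
  by rewrite multpP // ltnn.
have [a' ea pa] := split_mult a a0; have [b' eb pb] := split_mult b b0.
have cpa : coprimep p a' by rewrite irreducible_poly_coprime.
have nab : ~~ (p ^+ (multp p a + multp p b).+1 %| a * b).
  have -> : a * b = p ^+ (multp p a + multp p b) * (a' * b').
    by rewrite {1}ea {1}eb mulrACA -exprD.
  by rewrite exprSr dvdp_mul2l ?expf_neq0 // Gauss_dvdpr.
have ab0 : a * b != 0 by rewrite mulf_neq0.
apply/eqP; rewrite eqn_leq leqNgt -multpP // nab -multpP //= exprD.
by rewrite dvdp_mul ?multpP.
Qed.

Lemma ordp_div p a b : irreducible_poly p -> a != 0 -> b != 0 ->
  ordp p (a%:F / b%:F) = ((multp p a)%:Z - (multp p b)%:Z)%:E.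
Proof.
move=> pI a0 b0; set f := _ / _; have d0 := denf_neq0 f.
have f0 : f != 0 by rewrite mulf_neq0 ?invr_eq0 ?tofrac_eq0.
have n0 : numf f != 0.
  by apply: contraNneq f0 => n0; rewrite (numf_denf f) n0 tofrac0 mul0r.
rewrite /ordp (negPf f0); congr EFin.
have /eqP := numf_denf f; rewrite {1}/f eq_divF // => /eqP/(congr1 (multp p)).
rewrite !multpM // => e; apply/eqP.
by rewrite subr_eq addrAC eq_sym subr_eq -!PoszD e.
Qed.

End RationalFunctions.

Section Systems.
Variables (C : fieldType) (d : nat).
Local Notation ratfun := {fraction {poly C}}.
Implicit Types (A : 'M[ratfun]_d) (q : {poly C}) (T : 'M[{poly C}]_d).

Definition ordmx (p : {poly C}) A : \bar int :=
  \big[Order.min/+oo%E]_(i < d) \big[Order.min/+oo%E]_(j < d) ordp p (A i j).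

Definition has_pole A q : Prop := (ordmx q A < 0%E)%O.

Definition single_simple_pole A q : Prop :=
  has_pole A q /\ exists B : 'M[{poly C}]_d, q%:F *: A = ratmx B.

(* The matrix of the transformed system T[A]_phi *)
Definition transform (T A : 'M[ratfun]_d) : 'M[ratfun]_d :=
  map_mx (@phi C) (invmx T) *m A *m T.

(* Membership in GL_d(C(z)) of a polynomial matrix *)
Definition nonsingular T : Prop := ratmx T \in unitmx.

Definition desingularizing A q T : Prop :=
  [/\ nonsingular T,
      (0%E <= ordmx q (transform (ratmx T) A))%O
    & forall p : {poly C}, irreducible_poly p -> ~~ (p %= q) ->
        (ordmx p A <= ordmx p (transform (ratmx T) A))%O].

Definition desingularizable A q : Prop := exists T, desingularizing A q T.

End Systems.

(* Main.v *)
(* The image lattice T C[z]^d of a desingularizing T lies in C[z]^d, and a sum of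
   such lattices is again one: A maps T C[z]^d into phi(T) C[z]^d up to entries of
   the prescribed orders, and those orders survive sums and products with
   polynomials. Diagonalizing [T T'] over the Euclidean ring C[z] as S [D 0] R
   shows that S D spans the sum of the lattices of T and T'. A desingularizing
   S D with det of least degree therefore spans the largest lattice, so it is a
   left divisor of every T', and n = 1 suffices. *)
Require Import Defs.
From HB Require Import structures.
From mathcomp Require Import all_boot all_order all_algebra.
From mathcomp Require Import reals complex.
From mathcomp Require Import perm zify boolp constructive_ereal.

Set Implicit Arguments.
Unset Strict Implicit.
Unset Printing Implicit Defensive.

Import Order.TTheory GRing.Theory Num.Theory.
Local Open Scope ring_scope.

(** * Diagonal reduction of polynomial matrices *)

Section Diagonalization.
Variable F : fieldType.

(** Weaker than a Smith form: the diagonal entries need not divide one another. *)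
Definition diagonalizes m n (M : 'M[{poly F}]_(m, n)) : Prop :=
  exists L D R,
    [/\ L \in unitmx, R \in unitmx, is_diag_mx D & M = L *m D *m R].

Lemma diagonalizes_mul m n (L : 'M[{poly F}]_m) (M : 'M[{poly F}]_(m, n)) R :
  L \in unitmx -> R \in unitmx -> diagonalizes M -> diagonalizes (L *m M *m R).
Proof.
move=> Lu Ru [L' [D [R' [L'u R'u Dd ->]]]].
exists (L *m L'), D, (R' *m R); split; rewrite ?unitmx_mul ?Lu ?Ru ?L'u ?R'u //.
by rewrite !mulmxA.
Qed.

Lemma diagonalizes_tr m n (M : 'M[{poly F}]_(m, n)) :
  diagonalizes M^T -> diagonalizes M.
Proof.
move=> [L [D [R [Lu Ru Dd eM]]]]; exists R^T, D^T, L^T.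
split; rewrite ?unitmx_tr ?is_diag_trmx //.
by rewrite -[M]trmxK eM !trmx_mul mulmxA.
Qed.

Lemma unitmx_transvection m n (c : 'M[{poly F}]_(n, m)) :
  block_mx 1%:M 0 c 1%:M \in unitmx.
Proof. by rewrite unitmxE det_lblock !det1 mulr1 unitr1. Qed.

(* Subtracting multiples of the first row from the others replaces c by c %% a. *)
Lemma diagonalizes_modp m n a (r : 'rV[{poly F}]_n) (c : 'cV[{poly F}]_m)
    (M : 'M[{poly F}]_(m, n)) :
  (exists i, forall N : 'M[{poly F}]_(1 + m, 1 + n),
     N (rshift 1 i) 0 = c i 0 %% a -> diagonalizes N) ->
  diagonalizes (block_mx a%:M r c M : 'M_(1 + m, 1 + n)).
Proof.
case=> i dN; pose k := map_mx (fun x => x %/ a) c.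
have -> : block_mx a%:M r c M =
    block_mx 1%:M 0 k 1%:M *m block_mx a%:M r (c - k *m a%:M) (M - k *m r) *m 1%:M.
  rewrite mulmx1 mulmx_block !mul1mx !mul0mx !addr0.
  by rewrite ![_ + (_ - _)]addrC !subrK.
apply: diagonalizes_mul; rewrite ?unitmx1 ?unitmx_transvection //.
apply: dN; rewrite -[0 in LHS](lshift0 n 0) block_mxEdl.
rewrite mul_mx_scalar !mxE [a * _]mulrC.
by rewrite {1}(divp_eq (c i 0) a) addrAC subrr add0r.
Qed.

(** Euclidean elimination. The outer induction is on the number of rows, the inner one on a bound
    for the size of a nonzero entry, which is permuted to the corner as pivot [a]. If [a] fails to
    divide an entry of its column or row, the remainder is a smaller nonzero pivot; otherwise that
    column and row are cleared. *)
Lemma diagonalizesP m n (M : 'M[{poly F}]_(m, n)) : diagonalizes M.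
Proof.
elim: m => [|m IHm] in n M *.
  exists 1%:M, M, 1%:M; split; rewrite ?unitmx1 ?mulmx1 ?mul1mx //.
  by apply/is_diag_mxP => -[].
case: n => [|n] in M *.
  exists 1%:M, M, 1%:M; split; rewrite ?unitmx1 ?mulmx1 ?mul1mx //.
  by apply/is_diag_mxP => ? [].
have [->|/matrix0Pn[i [j Mij]]] := eqVneq M 0.
  exists 1%:M, 0, 1%:M; split; rewrite ?unitmx1 ?mulmx1 ?mulmx0 //.
  by apply/is_diag_mxP => *; rewrite mxE.
move: {2}(size _) (leqnn (size (M i j))) => k.
elim: k => [|k IHk] in i j M Mij *.
  by rewrite leqn0 size_poly_eq0 (negPf Mij).
move=> leMk; have -> : M = tperm_mx i 0 *m (xrow i 0 (xcol j 0 M)) *m tperm_mx j 0.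
  rewrite xrowE xcolE !mulmxA -mulmxA -!perm_mxM.
  by rewrite !tperm2 !perm_mx1 mul1mx mulmx1.
apply: diagonalizes_mul; rewrite ?unitmx_perm //.
have : xrow i 0 (xcol j 0 M) 0 0 = M i j by rewrite !mxE !tpermR.
move: (xrow _ _ _) => N; rewrite -[m.+1]/(1 + m)%N -[n.+1]/(1 + n)%N in N * => eN.
move: (M i j) Mij leMk eN => a a0 leak eN.
have ltk (x : {poly F}) : (size (x %% a)%R <= k)%N.
  by rewrite -ltnS (leq_trans _ leak) // ltn_modp.
have -> : N = block_mx a%:M (ursubmx N) (dlsubmx N) (drsubmx N).
  rewrite -[LHS]submxK; congr block_mx; apply/matrixP => x y.
  by rewrite !ord1 !mxE mulr1n -eN; congr (N _ _); apply: val_inj.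
move: (ursubmx N) (dlsubmx N) (drsubmx N) => r c M1.
have [/existsP[x cx]|/existsPn cP] := boolP [exists x, c x 0 %% a != 0].
  apply: diagonalizes_modp; exists x => N' eN'.
  by apply: (IHk (rshift 1 x) 0 N'); rewrite eN'.
have [/existsP[x rx]|/existsPn rP] := boolP [exists x, r 0 x %% a != 0].
  apply: diagonalizes_tr; rewrite tr_block_mx tr_scalar_mx.
  apply: diagonalizes_modp; exists x; rewrite mxE => N' eN'.
  apply: diagonalizes_tr; have e' : N'^T 0 (rshift 1 x) = r 0 x %% a by rewrite mxE.
  by apply: (IHk 0 (rshift 1 x)); rewrite e'.
pose u := map_mx (fun x => x %/ a) c; pose v := map_mx (fun x => x %/ a) r.
have ec : u *m a%:M = c.
  apply/matrixP => x y; rewrite mul_mx_scalar !mxE ord1 mulrC divpK //.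
  by move: (cP x); rewrite negbK.
have er : a%:M *m v = r.
  apply/matrixP => x y; rewrite mul_scalar_mx !mxE ord1 mulrC divpK //.
  by move: (rP y); rewrite negbK.
(* The Schur complement of the pivot; it stays polynomial because [a] divides [c]. *)
have [L [D [R [Lu Ru Dd eM]]]] := IHm n (M1 - u *m r).
exists (block_mx 1%:M 0 u 1%:M *m block_mx 1%:M 0 0 L), (block_mx a%:M 0 0 D),
  (block_mx 1%:M 0 0 R *m block_mx 1%:M v 0 1%:M); split.
- by rewrite unitmx_mul unitmx_transvection unitmxE det_lblock det1 mul1r -unitmxE.
- by rewrite unitmx_mul !unitmxE !det_ublock !det1 !mul1r -unitmxE Ru unitr1.
- by rewrite is_diag_block_mx // !eqxx scalar_mx_is_diag.
- rewrite !mulmx_block !(mul1mx, mul0mx, mulmx1, mulmx0, addr0, add0r).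
  have ecv : c *m v = u *m r by rewrite -ec -mulmxA er.
  by rewrite er ec ecv -eM addrC subrK.
Qed.

End Diagonalization.

(** * Lower bounds for the p-adic valuation *)

Section Valuation.
Variables (C : fieldType) (p : {poly C}).
Hypothesis pI : irreducible_poly p.
Local Notation ratfun := {fraction {poly C}}.
Implicit Types f g : ratfun.

Lemma ordp0 : ordp p (0 : ratfun) = +oo%E.
Proof. by rewrite /ordp eqxx. Qed.

Lemma ratfun_neq0P f : f != 0 ->
  exists a b, [/\ a != 0, b != 0 & f = a%:F / b%:F].
Proof.
move=> f0; exists (numf f), (denf f); split; rewrite ?denf_neq0 //; last exact: numf_denf.
by apply: contraNneq f0 => n0; rewrite (numf_denf f) n0 tofrac0 mul0r.
Qed.

Lemma ordpD f g : (Order.min (ordp p f) (ordp p g) <= ordp p (f + g))%O.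
Proof.
have [->|f0] := eqVneq f 0; first by rewrite add0r ge_min lexx orbT.
have [->|g0] := eqVneq g 0; first by rewrite addr0 ge_min lexx.
have [->|] := eqVneq (f + g) 0; first by rewrite ordp0 leey.
have [a [b [a0 b0 ->]]] := ratfun_neq0P f0.
have [a' [b' [a'0 b'0 ->]]] := ratfun_neq0P g0.
(* Over the common denominator [b * b'], only the numerators matter, and a power of [p] that divides
   both divides their sum. *)
have -> : a%:F / b%:F = (a * b')%:F / (b * b')%:F.
  by apply/eqP; rewrite eq_divF ?mulf_neq0 // -mulrA [b' * b]mulrC.
have -> : a'%:F / b'%:F = (a' * b)%:F / (b * b')%:F.
  by apply/eqP; rewrite eq_divF ?mulf_neq0 // -mulrA.
have: a * b' != 0 by rewrite mulf_neq0.
have: a' * b != 0 by rewrite mulf_neq0.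
have: b * b' != 0 by rewrite mulf_neq0.
move: (a * b') (a' * b) (b * b') => {a0 b0 a'0 b'0 f0 g0}x y c c0 y0 x0.
rewrite -mulrDl -tofracD mulf_eq0 negb_or tofrac_eq0 => /andP[xy0 _].
rewrite !ordp_div // ge_min !lee_fin !lerD2r !lez_nat.
rewrite -!multpP ?pI.1 //; case: (leqP (multp p x) (multp p y)) => [le_xy|/ltnW le_yx].
  by rewrite dvdp_add // multpP ?pI.1.
by apply/orP; right; rewrite dvdp_add // multpP ?pI.1.
Qed.

Lemma ordp_polyM (a : {poly C}) f : (ordp p f <= ordp p (a%:F * f))%O.
Proof.
have [->|a0] := eqVneq a 0; first by rewrite tofrac0 mul0r ordp0 leey.
have [->|f0] := eqVneq f 0; first by rewrite mulr0.
have [b [c [b0 c0 ->]]] := ratfun_neq0P f0.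
rewrite mulrA -tofracM !ordp_div ?mulf_neq0 // multpM // lee_fin lerD2r lez_nat.
by rewrite leq_addl.
Qed.

End Valuation.

(** * Orders of sums and products of matrices *)

Section MatrixValuation.
Variables (C : fieldType) (d : nat) (p : {poly C}).
Hypothesis pI : irreducible_poly p.
Implicit Types (M N : 'M[{fraction {poly C}}]_d) (X : 'M[{poly C}]_d).

(** The initial value [+oo] of the minimum lies above every [b], so it adds no condition, even for
    [d = 0]. *)
Lemma ordmx_geP b M :
  reflect (forall i j, (b <= ordp p (M i j))%O) (b <= ordmx p M)%O.
Proof.
apply: (iffP (bigmin_geP _ _ _ _)) => [[_ bM] i j|bM].
  by have /bigmin_geP[_ ->] := bM i isT.
by rewrite leey; split=> // i _; apply/bigmin_geP; rewrite leey; split=> // j _.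
Qed.

Lemma ordmxD b M N :
  (b <= ordmx p M)%O -> (b <= ordmx p N)%O -> (b <= ordmx p (M + N))%O.
Proof.
move=> /ordmx_geP bM /ordmx_geP bN; apply/ordmx_geP => i j.
by rewrite mxE (le_trans _ (ordpD pI _ _)) // le_min bM bN.
Qed.

Lemma ordp_sum b (f : 'I_d -> {fraction {poly C}}) :
  (forall i, (b <= ordp p (f i))%O) -> (b <= ordp p (\sum_i f i))%O.
Proof.
move=> bf; apply: (big_ind (fun x => (b <= ordp p x)%O)) => //.
  by rewrite ordp0 leey.
by move=> x y bx b_y; rewrite (le_trans _ (ordpD pI _ _)) // le_min bx b_y.
Qed.

Lemma ordmx_polyMl b X M :
  (b <= ordmx p M)%O -> (b <= ordmx p (ratmx X *m M))%O.
Proof.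
move=> /ordmx_geP bM; apply/ordmx_geP => i j; rewrite mxE.
by apply: ordp_sum => k; rewrite mxE (le_trans (bM k j)) // ordp_polyM.
Qed.

Lemma ordmx_polyMr b X M :
  (b <= ordmx p M)%O -> (b <= ordmx p (M *m ratmx X))%O.
Proof.
move=> /ordmx_geP bM; apply/ordmx_geP => i j; rewrite mxE.
by apply: ordp_sum => k; rewrite mxE mulrC (le_trans (bM i k)) // ordp_polyM.
Qed.

End MatrixValuation.

(** The right factor [U] is expanded as a sum, and each summand is paired with the expression of
    [invmx U] through the same matrix, [T] or [T']. *)
Lemma gauge_sum (K : fieldType) (s : {rmorphism K -> K}) d
    (A U T T' X Y X1 X2 : 'M[K]_d) :
  invmx U = X *m invmx T -> invmx U = Y *m invmx T' -> U = T *m X1 + T' *m X2 ->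
  map_mx s (invmx U) *m A *m U =
    map_mx s X *m (map_mx s (invmx T) *m A *m T) *m X1 +
    map_mx s Y *m (map_mx s (invmx T') *m A *m T') *m X2.
Proof.
move=> eX eY eU; rewrite {2}eU mulmxDr !mulmxA; congr (_ + _).
  by rewrite eX map_mxM.
by rewrite eY map_mxM.
Qed.

(** * Sums of lattices and the largest desingularizing lattice *)

Section Desingularizing.
Variables (C : fieldType) (d : nat).
Variables (A : 'M[{fraction {poly C}}]_d) (q : {poly C}).
Hypothesis qI : irreducible_poly q.
Implicit Types (S D T U X Y : 'M[{poly C}]_d).

Lemma nonsingularM T X :
  nonsingular (T *m X) <-> nonsingular T /\ nonsingular X.
Proof. by rewrite /nonsingular map_mxM unitmx_mul; split=> /andP. Qed.

Lemma nonsingular_det T : nonsingular T <-> \det T != 0.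
Proof. by rewrite /nonsingular unitmxE det_map_mx unitfE tofrac_eq0. Qed.

(** Since [phi] preserves polynomial matrices, the left coefficients in [gauge_sum] do not lower
    orders. *)
Lemma map_phi_ratmx X :
  map_mx (@phi C) (ratmx X) = ratmx (map_mx (fun a => a \Po ('X + 1%:P)) X).
Proof. by apply/matrixP => i j; rewrite !mxE /phi shift_poly. Qed.

Lemma invmx_factor T U X : nonsingular T -> T = U *m X ->
  invmx (ratmx U) = ratmx X *m invmx (ratmx T).
Proof.
move=> Tn eT; have Un : nonsingular U by move: Tn; rewrite eT => /nonsingularM[].
have -> : ratmx X = invmx (ratmx U) *m ratmx T by rewrite eT map_mxM mulKmx.
by rewrite (mulmxK Tn).
Qed.

(* The columns of U span the sum of the lattices of T and T'. *)
Lemma desingularizing_sum T T' U X Y X1 X2 :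
  desingularizing A q T -> desingularizing A q T' ->
  T = U *m X -> T' = U *m Y -> U = T *m X1 + T' *m X2 ->
  desingularizing A q U.
Proof.
move=> [Tn Tq Tp] [Tn' Tq' Tp'] eT eT' eU.
have Un : nonsingular U by move: Tn; rewrite eT => /nonsingularM[].
have eUr : ratmx U = ratmx T *m ratmx X1 + ratmx T' *m ratmx X2.
  by rewrite {1}eU map_mxD !map_mxM.
have etr : transform (ratmx U) A =
    map_mx (@phi C) (ratmx X) *m transform (ratmx T) A *m ratmx X1 +
    map_mx (@phi C) (ratmx Y) *m transform (ratmx T') A *m ratmx X2.
  exact: gauge_sum (invmx_factor Tn eT) (invmx_factor Tn' eT') eUr.
(* The bound [b] will be 0 at [q] and [ordmx p A] at the other primes. *)
have ge p b : irreducible_poly p -> (b <= ordmx p (transform (ratmx T) A))%O ->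
    (b <= ordmx p (transform (ratmx T') A))%O ->
    (b <= ordmx p (transform (ratmx U) A))%O.
  move=> pI bT bT'; rewrite etr !map_phi_ratmx.
  apply: (ordmxD pI); apply: (ordmx_polyMr pI).
    exact: (ordmx_polyMl pI _ bT).
  exact: (ordmx_polyMl pI _ bT').
split; [exact: Un | exact: ge qI Tq Tq' | move=> p pI pq].
exact: ge pI (Tp p pI pq) (Tp' p pI pq).
Qed.

(** [S *m D] is a greatest common left divisor of [T] and [T']: the top half of [R] holds the
    cofactors, the left half of its inverse the Bezout coefficients. *)
Lemma desingularizing_join T T' :
  desingularizing A q T -> desingularizing A q T' ->
  exists S D X Y, [/\ S \in unitmx, is_diag_mx D, desingularizing A q (S *m D),
    T = S *m D *m X & T' = S *m D *m Y].
Proof.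
move=> Td Td'.
have [S [D' [R [Su Ru D'd e]]]] := diagonalizesP (row_mx T T').
pose D := lsubmx D'.
(* [D'] has [d] rows, so a column index in its right half never equals a row index. *)
have eD' : D' = row_mx D 0.
  rewrite -[LHS]hsubmxK; congr row_mx; apply/matrixP => i j; rewrite !mxE.
  by have /is_diag_mxP-> // := D'd; rewrite neq_ltn /= ltn_addr.
have eR : row_mx T T' = S *m D *m usubmx R.
  by rewrite e -[in LHS](vsubmxK R) eD' -mulmxA mul_row_col mul0mx addr0 mulmxA.
exists S, D, (lsubmx (usubmx R)), (rsubmx (usubmx R)).
have [eT eT'] : T = S *m D *m lsubmx (usubmx R) /\ T' = S *m D *m rsubmx (usubmx R).
  by apply: eq_row_mx; rewrite eR -mul_mx_row hsubmxK.
have Dd : is_diag_mx D.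
  by apply/is_diag_mxP => i j ij; rewrite mxE; have /is_diag_mxP-> := D'd.
split; [exact: Su | exact: Dd | | exact: eT | exact: eT'].
have eSD : row_mx T T' *m lsubmx (invmx R) = S *m D.
  have := congr1 (mulmx^~ (invmx R)) e; rewrite mulmxK // eD' mul_mx_row mulmx0.
  by rewrite -[in LHS](hsubmxK (invmx R)) mul_mx_row => /eq_row_mx[].
apply: (@desingularizing_sum T T' _ _ _ (usubmx (lsubmx (invmx R)))
  (dsubmx (lsubmx (invmx R))) Td Td' eT eT').
by rewrite -mul_row_col vsubmxK.
Qed.

(* If T' is not a multiple of S D, the det of their join has smaller degree. *)
Lemma desingularizing_least T : desingularizing A q T ->
  exists S D, [/\ S \in unitmx, is_diag_mx D, desingularizing A q (S *m D)
    & forall T', desingularizing A q T' -> exists X, T' = S *m D *m X].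
Proof.
move: {2}(size _) (leqnn (size (\det T))) => k.
elim: k T => [|k IHk] T leTk Td.
  by have [/nonsingular_det/negP[]] := Td; rewrite -size_poly_eq0 -leqn0.
(* Joining [T] with itself replaces it by a matrix of the form [S *m D]. *)
have [S [D [X [_ [Su Dd SDd eT _]]]]] := desingularizing_join Td Td.
have [maxSD|] := EM (forall T', desingularizing A q T' -> exists X, T' = S *m D *m X).
  exists S, D; split; [exact: Su | exact: Dd | exact: SDd | exact: maxSD].
move=> /existsNP[T' /not_implyP[Td' nT']].
have [S' [D' [X' [Y' [Su' Dd' SDd' eSD eT']]]]] := desingularizing_join SDd Td'.
apply: (IHk (S' *m D')); last exact: SDd'.
rewrite -ltnS; apply: leq_trans leTk.
have [/nonsingular_det] := Td; rewrite eT eSD !det_mulmx !mulf_eq0 !negb_or.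
move=> /andP[/andP[/andP[s'0 d'0] x'0] x0] _ _.
rewrite !size_mul ?mulf_neq0 //.
(* A constant nonzero determinant would make [X'] unimodular, and [T'] would be [S *m D] times
   [invmx X' *m Y'], against the choice of [T']. *)
have x'1 : (1 < size (\det X'))%N.
  rewrite ltn_neqAle size_poly_gt0 x'0 andbT eq_sym; apply/negP => sx'.
  have Xu : X' \in unitmx.
    rewrite unitmxE poly_unitE sx' /= unitfE.
    by move/eqP: sx' x'0 => sx'; rewrite -lead_coef_eq0 lead_coefE sx'.
  by case: nT'; exists (invmx X' *m Y'); rewrite eSD mulmxA mulmxK.
move: s'0 d'0 x0; rewrite -!size_poly_gt0.
move: (size (\det S')) (size (\det D')) (size (\det X)) (size (\det X')) x'1.
lia.
Qed.

End Desingularizing.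

Theorem theorem3p10 (R : realType) (C : fieldType) (iota : {rmorphism C -> R[i]})
  (d : nat) (A : 'M[{fraction {poly C}}]_d) (q : {poly C})
  (Aunit : A \in unitmx) (qirr : irreducible_poly q)
  (Apole : single_simple_pole A q) (Adesing : desingularizable A q) :
  exists (n : nat) (S D : 'I_n -> 'M[{poly C}]_d),
    let T := \big[mulmx/1%:M]_(i < n) (S i *m D i) in
    [/\ (1 <= n)%N,
        forall i, S i \in unitmx,
        forall i, is_diag_mx (D i),
        desingularizing A q T
      & forall T' : 'M[{poly C}]_d, desingularizing A q T' ->
          exists Tt : 'M[{poly C}]_d, nonsingular Tt /\ T' = T *m Tt].
Proof.
have [T0 /(desingularizing_least qirr)[S [D [Su Dd SDd max]]]] := Adesing.
exists 1, (fun=> S), (fun=> D); rewrite big_ord_recl big_ord0 mulmx1.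
split=> [//|//|//||T' Td']; first exact: SDd.
(* The cofactor inherits nonsingularity from the product [T']. *)
have [X eT'] := max _ Td'; exists X; split; last exact: eT'.
by have [] := Td'; rewrite eT' => /nonsingularM[].
Qed.
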